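(* Let $J_2$ be the second Janko group, with conjugacy classes named as in the ATLAS of Finite Groups. Then: (a) $J_2$ is $(2B,3B,7A)$-, $(2A,5C,7A)$-, $(2B,5A,7A)$-, $(2B,5C,7A)$-, $(3A,5C,7A)$-, $(3B,5A,7A)$-, and $(3B,5C,7A)$-generated. (b) $J_2$ is not $(2A,3A,7A)$-generated, not $(2A,3B,7A)$-generated, not $(2B,3A,7A)$-generated, not $(2A,5A,7A)$-generated, and not $(3A,5A,7A)$-generated.
   Context: The Janko group $J_2$ is the sporadic simple group of order $604800 = 2^7\cdot 3^3\cdot 5^2\cdot 7$ (it is, up to isomorphism, the unique simple group of this order). For conjugacy classes $C_1,C_2,C_3$ of a finite group $G$, the group $G$ is called $(C_1,C_2,C_3)$-generated if there exist $a\in C_1$ and $b\in C_2$ such that $ab\in C_3$ and $G=\langle a,b\rangle$. ATLAS names of the relevant conjugacy classes of $J_2$: there are two classes of involutions, $2A$ (centralizer order $1920$) and $2B$ (centralizer order $240$); two classes of elements of order $3$, $3A$ (centralizer order $1080$) and $3B$ (centralizer order $36$); four classes of elements of order $5$, namely $5A,5B$ (centralizer order $300$; algebraically conjugate to each other, $5B$ consisting of the squares of elements of $5A$) and $5C,5D$ (centralizer order $50$; algebraically conjugate to each other, $5D$ consisting of the squares of elements of $5C$); and a single class $7A$ of elements of order $7$ (centralizer order $7$). *)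

(* Defs.v *)
From mathcomp Require Import all_boot all_fingroup all_solvable.

Set Implicit Arguments.
Unset Strict Implicit.
Unset Printing Implicit Defensive.

(* The standard generators of J_2 (a in 2B, b in 3B, ab of order 7 and ababb
   of order 12) in its rank 3 action on the 100 vertices of the Hall-Janko
   graph, as given in the ATLAS of Group Representations. *)
Definition J2a_cycles : seq (seq nat) := [::
    [:: 1; 84]; [:: 2; 20]; [:: 3; 48]; [:: 4; 56]; [:: 5; 82]; [:: 6; 67];
    [:: 7; 55]; [:: 8; 41]; [:: 9; 35]; [:: 10; 40]; [:: 11; 78];
    [:: 12; 100]; [:: 13; 49]; [:: 14; 37]; [:: 15; 94]; [:: 16; 76];
    [:: 17; 19]; [:: 18; 44]; [:: 21; 34]; [:: 22; 85]; [:: 23; 92];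
    [:: 24; 57]; [:: 25; 75]; [:: 26; 28]; [:: 27; 64]; [:: 29; 90];
    [:: 30; 97]; [:: 31; 38]; [:: 32; 68]; [:: 33; 69]; [:: 36; 53];
    [:: 39; 61]; [:: 42; 73]; [:: 43; 91]; [:: 45; 86]; [:: 46; 81];
    [:: 47; 89]; [:: 50; 93]; [:: 51; 96]; [:: 52; 72]; [:: 54; 74];
    [:: 58; 99]; [:: 59; 95]; [:: 60; 63]; [:: 62; 83]; [:: 65; 70];
    [:: 66; 88]; [:: 71; 87]; [:: 77; 98]; [:: 79; 80]].

Definition J2b_cycles : seq (seq nat) := [::
    [:: 1; 80; 22]; [:: 2; 9; 11]; [:: 3; 53; 87]; [:: 4; 23; 78];
    [:: 5; 51; 18]; [:: 6; 37; 24]; [:: 8; 27; 60]; [:: 10; 62; 47];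
    [:: 12; 65; 31]; [:: 13; 64; 19]; [:: 14; 61; 52]; [:: 15; 98; 25];
    [:: 16; 73; 32]; [:: 17; 39; 33]; [:: 20; 97; 58]; [:: 21; 96; 67];
    [:: 26; 93; 99]; [:: 28; 57; 35]; [:: 29; 71; 55]; [:: 30; 69; 45];
    [:: 34; 86; 82]; [:: 38; 59; 94]; [:: 40; 43; 91]; [:: 42; 68; 44];
    [:: 46; 85; 89]; [:: 48; 76; 90]; [:: 49; 92; 77]; [:: 50; 66; 88];
    [:: 54; 95; 56]; [:: 63; 74; 72]; [:: 70; 81; 75]; [:: 79; 100; 83]].

Import GroupScope.

(* The points 1, ..., 100 are the elements of 'I_100, shifted by one. *)
Definition pt (k : nat) : 'I_100 := inord k.-1.

(* Permutations compose from left to right, so the product of the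
   transpositions (c_0 c_i), i = 1, 2, ..., is the cycle (c_0 c_1 c_2 ...). *)
Definition cycle_perm (c : seq nat) : 'S_100 :=
  \prod_(k <- behead c) tperm (pt (head 0 c)) (pt k).

Definition J2a : 'S_100 := \prod_(c <- J2a_cycles) cycle_perm c.
Definition J2b : 'S_100 := \prod_(c <- J2b_cycles) cycle_perm c.

(* That this is the second Janko group is confirmed by card_J2 and simple_J2
   below: J_2 is the only simple group of order 604800, up to isomorphism. *)
Definition J2 : {group 'S_100} := <<[set J2a; J2b]>>%G.

Definition triple_generated (gT : finGroupType) (G : {group gT})
    (C1 C2 C3 : {set gT}) : Prop :=
  exists a b : gT,
    [/\ a \in C1, b \in C2, a * b \in C3 & <<[set a; b]>> = G :> {set gT}].

(* C is a conjugacy class of G, of elements of order n with centralizers of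
   order m. *)
Definition is_class (gT : finGroupType) (G : {group gT}) (n m : nat)
    (C : {set gT}) : Prop :=
  exists2 x, x \in G & [/\ #[x] = n, #|'C_G[x]| = m & C = x ^: G].

(* An ATLAS labelling of the classes of elements of order 2, 3, 5 and 7. The
   labels 5A and 5B can be exchanged (each of these classes consists of the
   squares of the elements of the other one), and so can 5C and 5D; all other
   labels are determined by the orders of elements and centralizers. *)
Record ATLAS_classes (gT : finGroupType) (G : {group gT}) := {
  c2A : {set gT}; c2A_class : is_class G 2 1920 c2A;
  c2B : {set gT}; c2B_class : is_class G 2 240 c2B;
  c3A : {set gT}; c3A_class : is_class G 3 1080 c3A;
  c3B : {set gT}; c3B_class : is_class G 3 36 c3B;
  c5A : {set gT}; c5A_class : is_class G 5 300 c5A;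
  c5B : {set gT}; c5B_class : is_class G 5 300 c5B;
  c5B_squares : c5B = [set x ^+ 2 | x in c5A];
  c5C : {set gT}; c5C_class : is_class G 5 50 c5C;
  c5D : {set gT}; c5D_class : is_class G 5 50 c5D;
  c5D_squares : c5D = [set x ^+ 2 | x in c5C];
  c7A : {set gT}; c7A_class : is_class G 7 7 c7A
}.

(* The order and the simplicity of J2. Permutations are handled through their
   tables of values, which can be computed with. *)
Module J2Tables.

Definition tab (g : 'S_100) : seq nat := [seq val (g i) | i <- enum 'I_100].

Definition tcomp (s t : seq nat) := [seq nth 0 t i | i <- s].
Definition tid := iota 0 100.
Definition tinv (s : seq nat) := [seq index i s | i <- tid].

Lemma size_tab (g : 'S_100) : size (tab g) = 100.
Proof. by rewrite size_map size_enum_ord. Qed.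

Lemma nth_tab (g : 'S_100) (i : 'I_100) : nth 0 (tab g) i = g i.
Proof. by rewrite (nth_map i) ?size_enum_ord // nth_ord_enum. Qed.

Lemma tabP (g : 'S_100) s : size s = 100 ->
  (forall i : 'I_100, nth 0 s i = g i) -> tab g = s.
Proof.
move=> sz_s eq_gs; apply: (@eq_from_nth _ 0); rewrite size_tab ?sz_s //.
by move=> i lti; rewrite (nth_tab g (Ordinal lti)) -eq_gs.
Qed.

Lemma tab_inj : injective tab.
Proof.
move=> g h eq_gh; apply/permP=> i; apply: val_inj.
by rewrite /= -!nth_tab eq_gh.
Qed.

Lemma tabM g h : tab (g * h) = tcomp (tab g) (tab h).
Proof.
apply: tabP => [|i]; first by rewrite size_map size_tab.
by rewrite (nth_map 0) ?size_tab // nth_tab (nth_tab h (g i)) permM.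
Qed.

Lemma tab1 : tab 1 = tid.
Proof. by apply: tabP => // i; rewrite nth_iota // perm1. Qed.

Lemma tabV g : tab g^-1 = tinv (tab g).
Proof.
apply: tabP => [|i]; first by rewrite size_map.
rewrite (nth_map 0) // nth_iota // add0n.
have -> : val i = nth 0 (tab g) (g^-1 i) by rewrite nth_tab permKV.
rewrite index_uniq ?size_tab // map_inj_uniq ?enum_uniq //.
exact: inj_comp val_inj perm_inj.
Qed.

Fixpoint cyc_img (h : nat) (c : seq nat) (k : nat) : nat :=
  if c is j :: c' then
    cyc_img h c' (if k == h then j else if k == j then h else k)
  else k.

Definition tcycle (c : seq nat) : seq nat :=
  [seq cyc_img (head 0 c).-1 [seq k.-1 | k <- behead c] i | i <- tid].

Lemma tab_cycle c : all (fun k => k <= 100) c -> tab (cycle_perm c) = tcycle c.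
Proof.
move=> c_ok; apply: tabP => [|i]; first by rewrite size_map.
rewrite (nth_map 0) // nth_iota // add0n /cycle_perm.
case: c c_ok => [|h c] /=; first by rewrite big_nil perm1.
have val_pt k : k <= 100 -> val (pt k) = k.-1.
  by case: k => [|k] lek; rewrite /= inordK.
case/andP=> /val_pt def_h; elim: c i => [|j c IHc] i /=.
  by rewrite big_nil perm1.
case/andP=> /val_pt def_j /IHc {}IHc; rewrite big_cons permM -IHc.
congr (cyc_img _ _ _); rewrite -def_h -def_j !val_eqE.
by case: tpermP => [->|->|/eqP/negPf-> /eqP/negPf->]; rewrite ?eqxx //;
  case: eqP => // ->.
Qed.

Definition tcycles (cs : seq (seq nat)) := foldr (tcomp \o tcycle) tid cs.

Lemma tab_cycles cs : all (all (fun k => k <= 100)) cs ->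
  tab (\prod_(c <- cs) cycle_perm c) = tcycles cs.
Proof.
elim: cs => [|c cs IHcs] /=; first by rewrite big_nil tab1.
by case/andP=> /tab_cycle c_ok /IHcs {}IHcs; rewrite big_cons tabM c_ok IHcs.
Qed.

Definition ta := Eval vm_compute in tcycles J2a_cycles.
Definition tb := Eval vm_compute in tcycles J2b_cycles.

Lemma tab_a : tab J2a = ta.
Proof. by rewrite tab_cycles; vm_compute. Qed.

Lemma tab_b : tab J2b = tb.
Proof. by rewrite tab_cycles; vm_compute. Qed.

Definition inH (H : {set 'S_100}) (s : seq nat) := exists2 g, g \in H & tab g = s.

Lemma inH_comp (H : {group 'S_100}) s t : inH H s -> inH H t -> inH H (tcomp s t).
Proof. by case=> g Hg <- [h Hh <-]; exists (g * h); rewrite ?groupM ?tabM. Qed.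

Lemma inH1 (H : {group 'S_100}) : inH H tid.
Proof. by exists 1; rewrite ?group1 ?tab1. Qed.

Lemma inH_sub (H K : {set 'S_100}) s : H \subset K -> inH H s -> inH K s.
Proof. by move=> /subsetP sHK [g /sHK Kg <-]; exists g. Qed.

Definition tword (S : seq (seq nat)) (w : seq nat) : seq nat :=
  foldr (fun i => tcomp (nth tid S i)) tid w.

Lemma inH_word (H : {group 'S_100}) S w :
  {in S, forall s, inH H s} -> inH H (tword S w).
Proof.
move=> HS; elim: w => [|i w IHw] /=; first exact: inH1.
apply: inH_comp IHw; have [ltiS | leSi] := ltnP i (size S).
  exact/HS/mem_nth.
by rewrite nth_default //; apply: inH1.
Qed.

(* A transversal of the stabilizer of x, with one table for each point of the
   orbit of x under the group generated by S. *)
Definition torbit_add (x : nat) (T : seq (seq nat)) (u : seq nat) :=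
  if has (fun t => nth 0 t x == nth 0 u x) T then T else rcons T u.
Definition torbit_step (S : seq (seq nat)) (x : nat) (T : seq (seq nat)) :=
  foldl (torbit_add x) T [seq tcomp t s | t <- T, s <- S].
Definition torbit (S : seq (seq nat)) (x : nat) :=
  iter 40 (torbit_step S x) [:: tid].

Lemma inH_torbit (H : {group 'S_100}) S x :
  {in S, forall s, inH H s} -> {in torbit S x, forall t, inH H t}.
Proof.
move=> HS; rewrite /torbit; move: (40 in X in iter X) => m.
elim: m => [|n IHn] /=.
  by move=> t; rewrite inE => /eqP->; apply: inH1.
move: (iter n _ _) IHn => T HT; rewrite /torbit_step.
have: {in [seq tcomp t s | t <- T, s <- S], forall t, inH H t}.
  by move=> _ /allpairsP[[t s] [/HT Ht /HS Hs ->]]; apply: inH_comp.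
move: [seq tcomp t s | t <- T, s <- S] => U; elim: U T HT => //= u U IHU T HT HU.
apply: IHU => [t|t Ut]; last by apply: HU; rewrite inE Ut orbT.
rewrite /torbit_add; case: ifP => _; first exact: HT.
by rewrite mem_rcons inE => /predU1P[->|/HT //]; apply/HU/mem_head.
Qed.

(* A stabilizer chain is a list of base points x with, for each point y of the
   orbit of x, a permutation mapping y to x. *)
Definition tchain := seq (nat * seq (nat * seq nat)).
Definition tlink (x : nat) (T : seq (seq nat)) :=
  (x, [seq (nth 0 t x, tinv t) | t <- T]).

Fixpoint sift (L : tchain) (s : seq nat) : bool :=
  if L is (x, U) :: L' then
    if [seq u <- U | u.1 == nth 0 s x] is u :: _
    then sift L' (tcomp s u.2) else false
  else s == tid.

Definition inH_chain (H : {set 'S_100}) (L : tchain) :=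
  forall xU, xU \in L -> {in xU.2, forall u, inH H u.2}.

Lemma siftP (H : {group 'S_100}) L s :
  inH_chain H L -> sift L s -> forall g, tab g = s -> g \in H.
Proof.
elim: L s => [|[x U] L IHL] s HL /=.
  by move=> /eqP-> g; rewrite -tab1 => /tab_inj->; apply: group1.
case def_U: [seq u <- U | _] => [//|u U'] sLs g def_s.
have /andP[_ Uu]: (u.1 == nth 0 s x) && (u \in U).
  by rewrite -(mem_filter (fun u => u.1 == _)) def_U mem_head.
have [h Hh def_u] := HL _ (mem_head _ _) _ Uu.
rewrite -(groupMr g Hh); apply: IHL sLs _ _ => [xU LxU|].
  by apply: HL; rewrite inE LxU orbT.
by rewrite tabM def_s def_u.
Qed.

Lemma inH_cons (H K : {group 'S_100}) x T L :
  K \subset H -> {in T, forall t, inH H t} -> inH_chain K L ->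
  inH_chain H (tlink x T :: L).
Proof.
move=> sKH HT KL xU; rewrite inE => /predU1P[-> | /KL KxU] u /=.
  by case/mapP=> t /HT[h Hh <-] ->; exists h^-1; rewrite ?groupV ?tabV.
by move/KxU; apply: inH_sub.
Qed.

Definition tgroup (S : seq (seq nat)) : {group 'S_100} :=
  <<[set g | tab g \in S]>>%G.

Definition tlevel (S : seq (seq nat)) (x : nat) (L : tchain)
    (T S' : seq (seq nat)) :=
  let L' := tlink x T :: L in
  [&& x < 100, all (fun s => nth 0 s x == x) S', tid \in T,
      uniq [seq nth 0 t x | t <- T] &
    all (sift L') [seq tcomp t s | t <- T, s <- S]].

Lemma tlevelP S x L T S' :
  let H := tgroup S in let K := tgroup S' in
  {in T, forall t, inH H t} ->
  {in S, forall s, inH [set: 'S_100] s} ->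
  {in S', forall s, inH H s} ->
  inH_chain K L ->
  tlevel S x L T S' ->
  #|H| = (size T * #|K|)%N /\ 'C_H[inord x | 'P] = K :> {set 'S_100}.
Proof.
move=> H K HT S_perm HS' KL /and5P[ltx /allP fixS' idT uniqT closT].
pose p : 'I_100 := Ordinal ltx.
have -> : inord x = p by apply: val_inj; rewrite /= inordK.
have HS: {in S, forall s, inH H s}.
  by move=> s Ss; have [g _ def_s] := S_perm s Ss; exists g => //;
     rewrite mem_gen // inE def_s.
have sKH: K \subset H.
  rewrite gen_subG; apply/subsetP=> g; rewrite inE => /HS'[h Hh].
  by move/tab_inj <-.
have fixK: K \subset 'C[p | 'P].
  rewrite gen_subG; apply/subsetP=> g; rewrite inE => S'g.
  apply/astab1P; apply: val_inj; rewrite /= apermE -(nth_tab g p).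
  exact/eqP/fixS'.
have HKT g : g \in H ->
    exists k h : 'S_100, [/\ k \in K, tab h \in T & g = k * h].
  case/gen_prodgP=> n [c Sc ->]; elim: n c Sc => [|n IHn] c Sc.
    by exists 1, 1; rewrite big_ord0 mulg1 group1 tab1.
  have [|k [h [Kk Th]]] := IHn (fun i => c (widen_ord (leqnSn n) i)).
    by move=> i; apply: Sc.
  have:= Sc ord_max; rewrite big_ord_recr /= inE => Ss ->.
  move: (c _) Ss => s Ss.
  have /(allP closT)/=:
    tcomp (tab h) (tab s) \in [seq tcomp t s | t <- T, s <- S].
    exact: allpairs_f.
  case def_U: [seq u <- _ | _] => [//|u U'] sift_hsu.
  have /andP[_ /mapP[t Tt def_u]]:
    (u.1 == nth 0 (tcomp (tab h) (tab s)) x) && (u \in (tlink x T).2).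
    by rewrite -(mem_filter (fun u => u.1 == _)) def_U mem_head.
  have [h' Hh' def_t] := HT t Tt.
  exists (k * (h * s * h'^-1)), h'; rewrite def_t Tt !mulgA mulgKV; split=> //.
  rewrite -!mulgA groupMl // mulgA; apply: siftP KL sift_hsu _ _.
  by rewrite def_u !tabM tabV def_t.
have val_orb h : tab h \in T -> h p = nth 0 (tab h) x :> nat.
  by move=> _; rewrite (nth_tab h p).
have stabK: 'C_H[p | 'P] = K.
  apply/eqP; rewrite eqEsubset subsetI sKH fixK !andbT; apply/subsetP=> g.
  case/setIP=> /HKT[k [h [Kk Th ->]]] /astab1P; rewrite /= apermE permM.
  have /astab1P := subsetP fixK k Kk; rewrite /= apermE => -> fix_h.
  suffices ->: h = 1 by rewrite mulg1.
  apply: tab_inj; rewrite tab1.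
  apply: contraTeq uniqT => neq_h.
  rewrite (perm_uniq (perm_map _ (perm_to_rem Th))) /= negb_and negbK.
  apply/orP; left; apply/mapP; exists tid.
    by move: idT; rewrite (perm_mem (perm_to_rem Th)) inE eq_sym (negPf neq_h).
  by rewrite (nth_tab h p) fix_h nth_iota.
split=> //; rewrite -(card_orbit_stab 'P H p) stabK; congr (_ * _)%N.
pose X : seq 'I_100 := [seq inord (nth 0 t x) | t <- T].
have valX: map val X = [seq nth 0 t x | t <- T].
  rewrite -map_comp; apply/eq_in_map=> t /HT[h _ <-] /=.
  by rewrite (nth_tab h p) inordK.
have uniqX: uniq X by apply: (@map_uniq _ _ val); rewrite valX.
rewrite -(size_map (fun t => inord (nth 0 t x) : 'I_100) T).
rewrite -(card_uniqP uniqX); apply: eq_card => i.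
apply/orbitP/mapP=> [[g /HKT[k [h [Kk Th ->]]] <-] | [t Tt ->]].
  exists (tab h) => //; rewrite /= apermE permM.
  have /astab1P := subsetP fixK k Kk; rewrite /= apermE => ->.
  by apply: val_inj; rewrite /= (nth_tab h p) inordK.
have [h Hh <-] := HT t Tt; exists h => //.
by apply: val_inj; rewrite /= apermE (nth_tab h p) inordK.
Qed.

Definition S0 := [:: ta; tb].
Definition W1 :=
  [:: [:: 0; 1%N; 0]; [:: 1%N; 0; 1%N; 1%N; 0; 1%N; 0; 1%N; 1%N; 0; 1%N]].
Definition W2 := [:: [:: 0; 1%N; 1%N; 1%N; 0]; [:: 1%N; 1%N; 0; 1%N; 0]].
Definition W3 := [:: [:: 0]].
Definition S1 := Eval vm_compute in map (tword S0) W1.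
Definition S2 := Eval vm_compute in map (tword S1) W2.
Definition S3 := Eval vm_compute in map (tword S2) W3.

Definition T3 := torbit S3 2.
Definition T2 := torbit S2 8.
Definition T1 := torbit S1 1.
Definition T0 := torbit S0 0.

Definition L3 := [:: tlink 2 T3].
Definition L2 := tlink 8 T2 :: L3.
Definition L1 := tlink 1 T1 :: L2.


Lemma inH_gen S : {in S, forall s, inH [set: 'S_100] s} ->
  {in S, forall s, inH (tgroup S) s}.
Proof.
move=> S_perm s Ss; have [g _ def_s] := S_perm s Ss.
by exists g => //; rewrite mem_gen // inE def_s.
Qed.

Lemma tgroup_S0 : tgroup S0 = J2.
Proof.
congr <<_>>%G; apply/setP=> g; rewrite !inE -tab_a -tab_b.
by rewrite !(inj_eq tab_inj).
Qed.

Lemma inH_S0 : {in S0, forall s, inH (tgroup S0) s}.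
Proof.
apply: inH_gen => s; rewrite !inE => /orP[] /eqP->.
  by exists J2a; rewrite ?inE ?tab_a.
by exists J2b; rewrite ?inE ?tab_b.
Qed.

Lemma inH_words (H : {group 'S_100}) S S' ws : S' = map (tword S) ws ->
  {in S, forall s, inH H s} -> {in S', forall s, inH H s}.
Proof. by move=> -> HS _ /mapP[w _ ->]; apply: inH_word. Qed.

Lemma inH_S1 : {in S1, forall s, inH (tgroup S0) s}.
Proof. by apply: (@inH_words _ _ _ W1) inH_S0; vm_compute. Qed.

Lemma inH_all (H : {set 'S_100}) (S : seq (seq nat)) :
  {in S, forall s, inH H s} -> {in S, forall s, inH [set: 'S_100] s}.
Proof. by move=> HS s /HS; apply/inH_sub/subsetT. Qed.

Lemma inH_S11 : {in S1, forall s, inH (tgroup S1) s}.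
Proof. exact/inH_gen/inH_all/inH_S1. Qed.

Lemma inH_S2 : {in S2, forall s, inH (tgroup S1) s}.
Proof. by apply: (@inH_words _ _ _ W2) inH_S11; vm_compute. Qed.

Lemma inH_S22 : {in S2, forall s, inH (tgroup S2) s}.
Proof. exact/inH_gen/inH_all/inH_S2. Qed.

Lemma inH_S3 : {in S3, forall s, inH (tgroup S2) s}.
Proof. by apply: (@inH_words _ _ _ W3) inH_S22; vm_compute. Qed.

Lemma inH_S33 : {in S3, forall s, inH (tgroup S3) s}.
Proof. exact/inH_gen/inH_all/inH_S3. Qed.

Lemma tgroup_sub (H : {group 'S_100}) S :
  {in S, forall s, inH H s} -> tgroup S \subset H.
Proof.
move=> HS; rewrite gen_subG; apply/subsetP=> g; rewrite inE => /HS[h Hh].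
by move/tab_inj <-.
Qed.

Lemma inH_T3 : {in T3, forall t, inH (tgroup S3) t}.
Proof. exact (@inH_torbit (tgroup S3) S3 2 inH_S33). Qed.

Lemma inH_T2 : {in T2, forall t, inH (tgroup S2) t}.
Proof. exact (@inH_torbit (tgroup S2) S2 8 inH_S22). Qed.

Lemma inH_T1 : {in T1, forall t, inH (tgroup S1) t}.
Proof. exact (@inH_torbit (tgroup S1) S1 1 inH_S11). Qed.

Lemma inH_T0 : {in T0, forall t, inH (tgroup S0) t}.
Proof. exact (@inH_torbit (tgroup S0) S0 0 inH_S0). Qed.

Lemma card_S3 : #|tgroup S3| = 3.
Proof.
have clT: tlevel S3 2 [::] T3 [::] by vm_compute.
have inH_nil: {in [::], forall s, inH (tgroup S3) s} by [].
have inL: inH_chain (tgroup [::]) [::] by [].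
have [-> _] :=
  @tlevelP S3 2 [::] T3 [::] inH_T3 (inH_all inH_S3) inH_nil inL clT.
have -> : size T3 = 3 by vm_compute.
suffices ->: tgroup [::] = 1%G by rewrite cards1.
by apply/val_inj; rewrite /= -gen0; congr <<_>>; apply/setP=> g; rewrite !inE.
Qed.

Lemma inH_L3 : inH_chain (tgroup S3) L3.
Proof.
have inH_nil: {in [::], forall s, inH (tgroup S3) s} by [].
have inL: inH_chain (tgroup [::]) [::] by [].
exact (@inH_cons _ (tgroup [::]) 2 T3 [::] (tgroup_sub inH_nil) inH_T3 inL).
Qed.

Lemma inH_L2 : inH_chain (tgroup S2) L2.
Proof.
exact (@inH_cons _ _ 8 T2 L3 (tgroup_sub inH_S3) inH_T2 inH_L3).
Qed.

Lemma inH_L1 : inH_chain (tgroup S1) L1.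
Proof.
exact (@inH_cons _ _ 1 T1 L2 (tgroup_sub inH_S2) inH_T1 inH_L2).
Qed.

Lemma card_S2 : #|tgroup S2| = 96.
Proof.
have clT: tlevel S2 8 L3 T2 S3 by vm_compute.
have [-> _] :=
  @tlevelP S2 8 L3 T2 S3 inH_T2 (inH_all inH_S2) inH_S3 inH_L3 clT.
have -> : size T2 = 32 by vm_compute.
by rewrite card_S3.
Qed.

Lemma card_S1 : #|tgroup S1| = (63 * 96)%N.
Proof.
have clT: tlevel S1 1 L2 T1 S2 by vm_compute.
have [-> _] :=
  @tlevelP S1 1 L2 T1 S2 inH_T1 (inH_all inH_S1) inH_S2 inH_L2 clT.
have -> : size T1 = 63 by vm_compute.
by rewrite card_S2.
Qed.

Lemma J2_stab :
  #|J2| = (100 * (63 * 96))%N /\ 'C_J2[inord 0 | 'P] = tgroup S1 :> {set 'S_100}.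
Proof.
rewrite -tgroup_S0.
have clT: tlevel S0 0 L1 T0 S1 by vm_compute.
have [-> ->] :=
  @tlevelP S0 0 L1 T0 S1 inH_T0 (inH_all inH_S0) inH_S1 inH_L1 clT.
have -> : size T0 = 100 by vm_compute.
rewrite card_S1; split; reflexivity.
Qed.

Lemma card_J2 : #|J2| = (2 ^ 7 * 3 ^ 3 * 5 ^ 2 * 7)%N.
Proof.
have e100: 100 = (2 ^ 2 * 5 ^ 2)%N by [].
have e6048: (63 * 96)%N = (2 ^ 5 * 3 ^ 3 * 7)%N by [].
have e128: (2 ^ 7)%N = (2 ^ 2 * 2 ^ 5)%N by [].
have [-> _] := J2_stab; rewrite e100 e6048 e128.
move: (2 ^ 2)%N (2 ^ 5)%N (3 ^ 3)%N (5 ^ 2)%N 7 => a b c d e.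
by rewrite !mulnA [(a * d * b)%N]mulnAC [(a * b * d * c)%N]mulnAC.
Qed.

Definition O63 := Eval vm_compute in [seq nth 0 t 1%N | t <- T1].
Definition O36 := Eval vm_compute in [seq nth 0 t 4 | t <- torbit S1 4].

Lemma card_pts (X : seq nat) : uniq X -> all (fun k => k < 100) X ->
  #|[set i : 'I_100 | val i \in X]| = size X.
Proof.
move=> uniqX /allP ltX; pose Y : seq 'I_100 := map inord X.
have defX: map val Y = X.
  rewrite -map_comp -[RHS]map_id; apply/eq_in_map=> k /ltX ltk /=.
  by rewrite inordK.
have uniqY: uniq Y by apply: (@map_uniq _ _ val); rewrite defX.
rewrite -(size_map (@inord 99) X) -(card_uniqP uniqY); apply: eq_card => i.
by rewrite inE -defX (mem_map val_inj).
Qed.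

Lemma orbit_pts (H : {group 'S_100}) x T X (B : {set 'I_100}) :
    x < 100 -> {in T, forall t, inH H t} -> X = [seq nth 0 t x | t <- T] ->
    (forall h i, h \in H -> i \in B -> h i \in B) ->
  forall i, i \in B -> val i \in X -> [set j : 'I_100 | val j \in X] \subset B.
Proof.
move=> ltx HT -> HB i Bi Xi; pose p : 'I_100 := Ordinal ltx.
have defX (j : 'I_100) : val j \in [seq nth 0 t x | t <- T] ->
    exists2 h : 'S_100, h \in H & j = h p.
  case/mapP=> t /HT[h Hh <-] def_j; exists h => //; apply: val_inj.
  by rewrite def_j (nth_tab h p).
have [h Hh def_i] := defX i Xi.
apply/subsetP=> j; rewrite inE => /defX[h' Hh' ->].
have -> : h' p = (h^-1 * h') i by rewrite def_i permM permK.
by apply: HB; rewrite ?groupM ?groupV.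
Qed.

Lemma block_pts (X36 X63 : seq nat) (B : {set 'I_100}) :
    size X36 = 36 -> size X63 = 63 -> perm_eq (0 :: X36 ++ X63) tid ->
    inord 0 \in B ->
    (forall i, i \in B -> val i \in X36 ->
       [set j : 'I_100 | val j \in X36] \subset B) ->
    (forall i, i \in B -> val i \in X63 ->
       [set j : 'I_100 | val j \in X63] \subset B) ->
  #|B| %| 100 -> B = [set inord 0] \/ B = setT.
Proof.
move=> sz36 sz63 permX B0 B36 B63 dvdB.
have mem_tid k : (k \in tid) = (k < 100) by rewrite mem_iota leq0n add0n.
have val0 (i : 'I_100) : (val i == 0) = (i == inord 0).
  by rewrite -val_eqE /= inordK.
have dO (i : 'I_100) : [|| i == inord 0, val i \in X36 | val i \in X63].
  have: val i \in tid by rewrite mem_tid ltn_ord.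
  by rewrite -(perm_mem permX) inE mem_cat val0.
have uniqX: uniq (0 :: X36 ++ X63) by rewrite (perm_uniq permX) iota_uniq.
have card0 X : subseq X (0 :: X36 ++ X63) ->
    #|[set i : 'I_100 | val i \in X]| = size X.
  move=> sX; apply: card_pts; first exact: subseq_uniq sX uniqX.
  by apply/allP=> k /(mem_subseq sX); rewrite (perm_mem permX) mem_tid.
have sub0 X : [set i : 'I_100 | val i \in X] \subset B ->
    [set i : 'I_100 | val i \in 0 :: X] \subset B.
  move/subsetP=> sb; apply/subsetP=> i; rewrite !inE val0.
  by case/predU1P=> [-> // | Xi]; apply: sb; rewrite inE.
have [/pred0P noB63 | /pred0Pn[i /andP[Bi Oi]]] :=
    boolP (pred0b [pred i : 'I_100 | (i \in B) && (val i \in X63)]);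
  have [/pred0P noB36 | /pred0Pn[j /andP[Bj Oj]]] :=
    boolP (pred0b [pred i : 'I_100 | (i \in B) && (val i \in X36)]).
- left; apply/setP=> k; rewrite !inE; apply/idP/eqP=> [Bk | -> //].
  have:= noB63 k; have:= noB36 k; rewrite /= Bk /= => k36 k63.
  by have:= dO k; rewrite k36 k63 !orbF => /eqP.
- have defB: B = [set i : 'I_100 | val i \in 0 :: X36].
    apply/eqP; rewrite eqEsubset (sub0 _ (B36 j Bj Oj)) andbT.
    apply/subsetP=> k Bk; have:= noB63 k; rewrite /= Bk /= => k63.
    by have:= dO k; rewrite k63 orbF !inE val0.
  by move: dvdB; rewrite defB card0 ?(prefix_subseq (0 :: X36)) //= sz36.
- have: #|[set i : 'I_100 | val i \in 0 :: X63]| <= #|B|.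
    exact: subset_leq_card (sub0 _ (B63 i Bi Oi)).
  rewrite card0 /= ?eqxx ?suffix_subseq // sz63 => cB.
  right; apply/eqP; rewrite eqEcard subsetT cardsT card_ord.
  case/dvdnP: dvdB => -[|[|q]] // def100; first by rewrite mul1n in def100; rewrite -def100.
  have: (2 * 64 <= q.+2 * #|B|)%N by apply: leq_mul.
  by rewrite -def100.
- right; apply/eqP; rewrite -subTset; apply/subsetP=> k _.
  case/or3P: (dO k) => [/eqP-> // | k36 | k63].
    by apply: (subsetP (B36 j Bj Oj)); rewrite inE.
  by apply: (subsetP (B63 i Bi Oi)); rewrite inE.
Qed.

Lemma O63E : O63 = [seq nth 0 t 1%N | t <- T1].
Proof. by vm_compute. Qed.

Lemma O36E : O36 = [seq nth 0 t 4 | t <- torbit S1 4].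
Proof. by vm_compute. Qed.

Lemma permO : perm_eq (0 :: O36 ++ O63) tid.
Proof. by vm_compute. Qed.

Lemma stab_block (B : {set 'I_100}) :
    inord 0 \in B -> (forall h i, h \in tgroup S1 -> i \in B -> h i \in B) ->
  #|B| %| 100 -> B = [set inord 0] \/ B = setT.
Proof.
move=> B0 S1B; apply: (block_pts _ _ permO B0) => // i.
  exact: (@orbit_pts _ 4 _ O36 B isT (@inH_torbit _ S1 4 inH_S11) O36E S1B).
exact: (@orbit_pts _ 1%N T1 O63 B isT inH_T1 O63E S1B).
Qed.

Lemma permO0 : perm_eq [seq nth 0 t 0 | t <- T0] tid.
Proof. by vm_compute. Qed.

Lemma nth_tab0 (g : 'S_100) : nth 0 (tab g) 0 = g (inord 0).
Proof. by rewrite -(nth_tab g) inordK. Qed.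

Lemma J2_trans (i : 'I_100) : exists2 g, g \in J2 & g (inord 0) = i.
Proof.
have: val i \in tid by rewrite mem_iota leq0n add0n ltn_ord.
rewrite -(perm_mem permO0) -tgroup_S0 => /mapP[t Tt def_i].
have [g Jg def_t] := inH_T0 Tt; exists g; first exact: Jg.
by apply: val_inj; rewrite def_i -def_t nth_tab0.
Qed.

Definition tpow5 s := tcomp s (tcomp s (tcomp s (tcomp s s))).

Lemma tab_pow5 (g : 'S_100) : tab (g ^+ 5) = tpow5 (tab g).
Proof. by rewrite !expgS expg0 mulg1 !tabM. Qed.

(* Elements u of order 5 such that u * J2a or u * J2b has order 5. *)
Definition word5a := [:: 1%N; 0; 1%N; 0; 1%N; 1%N; 0; 1%N; 1%N; 0; 1%N; 0; 1%N;
  0; 1%N; 1%N; 0; 1%N; 1%N; 0; 1%N; 0; 1%N; 1%N; 0; 1%N; 0; 1%N; 1%N; 0; 1%N].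
Definition word5b := [:: 0; 1%N; 0; 1%N; 1%N; 0; 1%N; 1%N; 0; 1%N; 0; 1%N; 0;
  1%N; 1%N; 0; 1%N; 0; 1%N; 0; 1%N; 1%N; 0; 1%N; 0; 1%N; 1%N; 0; 1%N].

Lemma J2_five (N : {group 'S_100}) :
  N \subset J2 -> {in J2, forall g, g ^+ 5 = 1 -> g \in N} -> N :=: J2.
Proof.
move=> sNJ N5; apply/eqP; rewrite eqEsubset sNJ gen_subG andTb.
have inN w c : c \in J2 ->
    (tpow5 (tword S0 w) == tid) && (tpow5 (tcomp (tword S0 w) (tab c)) == tid) ->
  c \in N.
  move=> Jc /andP[/eqP u5 /eqP uc5].
  have [u] := inH_word w inH_S0; rewrite tgroup_S0 => Ju def_u.
  have Nu: u \in N.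
    by apply: N5 => //; apply: tab_inj; rewrite tab_pow5 tab1 def_u.
  rewrite -(groupMl _ Nu); apply: N5; first exact: groupM.
  by apply: tab_inj; rewrite tab_pow5 tab1 tabM def_u.
have Ja: J2a \in J2 by rewrite mem_gen // !inE eqxx.
have Jb: J2b \in J2 by rewrite mem_gen // !inE eqxx orbT.
rewrite subUset !sub1set; apply/andP; split.
  by apply: (inN word5a _ Ja); rewrite tab_a; vm_compute.
by apply: (inN word5b _ Jb); rewrite tab_b; vm_compute.
Qed.

Lemma simple_J2 : simple J2.
Proof.
have [cardJ stabJ] := J2_stab; apply/simpleP; split.
  by rewrite trivg_card1 cardJ muln_eq1.
move=> N /andP[sNJ nNJ]; pose p0 : 'I_100 := inord 0.
pose H1 := tgroup S1; pose B := orbit 'P N p0.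
have sHJ: H1 \subset J2 by rewrite -stabJ subsetIl.
have stabN: 'C_N[p0 | 'P] = N :&: H1.
  by rewrite -stabJ setIA (setIidPl sNJ).
have cardN: (#|B| * #|N :&: H1|)%N = #|N| by rewrite -stabN card_orbit_stab.
have cardB: (#|B| * #|H1|)%N = #|N * H1|.
  apply/eqP; rewrite -(eqn_pmul2r (cardG_gt0 (N :&: H1))) -mul_cardG.
  by rewrite mulnAC cardN.
have dvdB: #|B| %| 100.
  rewrite -(dvdn_pmul2r (cardG_gt0 H1)) cardB /H1 card_S1 -cardJ.
  by rewrite -norm_joinEr ?cardSg ?join_subG ?sNJ // (subset_trans sHJ).
have HB h i : h \in H1 -> i \in B -> h i \in B.
  move=> Hh /orbitP[n Nn <-]; rewrite /= apermE -permM.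
  have /setIP[_ /astab1P] : h \in 'C_J2[p0 | 'P] by rewrite stabJ.
  rewrite /= apermE => hp0; rewrite conjgC permM hp0.
  apply/orbitP; exists (n ^ h) => //; rewrite memJ_norm //.
  exact: subsetP nNJ h (subsetP sHJ h Hh).
case: (@stab_block B (orbit_refl _ _ _) HB dvdB) => defB; [left | right].
  apply/trivgP/subsetP=> n Nn; rewrite inE; apply/eqP/permP=> i.
  have [g Jg <-] := J2_trans i; rewrite perm1 -permM.
  have Nng: n ^ g^-1 \in N.
    by rewrite memJ_norm // groupV; apply: subsetP nNJ g Jg.
  have: (n ^ g^-1) p0 \in B by apply/orbitP; exists (n ^ g^-1).
  rewrite defB inE => /eqP np0; rewrite conjgCV permM.
  by rewrite [X in g X]np0.
apply: (J2_five sNJ) => g Jg g5.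
have nNg: g \in 'N(N) := subsetP nNJ g Jg.
apply: (coset_idr nNg); apply/eqP; rewrite -order_eq1.
have dvd5: #[coset N g] %| 5.
  rewrite order_dvdn -morphX //; apply/eqP; transitivity (coset N 1).
    by congr (coset N _); apply: g5.
  exact: morph1.
have: coprime 5 #|J2 / N|.
  apply: (@coprime_dvdr _ (63 * 96)); last by [].
  have: (100 * #|J2 / N|)%N %| (100 * (63 * 96))%N.
    rewrite -cardJ card_quotient // -(Lagrange sNJ) dvdn_pmul2r //.
    by rewrite -cardN defB cardsT card_ord dvdn_mulr.
  by rewrite dvdn_pmul2l.
have dvdQ: #[coset N g] %| #|J2 / N|.
  by apply: order_dvdG; apply: mem_quotient.
move=> co5; rewrite -dvdn1; have := dvdn_gcd #[coset N g] 5 #|J2 / N|.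
by rewrite (eqP co5) dvd5 dvdQ.
Qed.

End J2Tables.

Lemma card_J2 : #|J2| = (2 ^ 7 * 3 ^ 3 * 5 ^ 2 * 7)%N.
Proof. exact J2Tables.card_J2. Qed.

Lemma simple_J2 : simple J2.
Proof. exact J2Tables.simple_J2. Qed.

(* Main.v *)
Require Import Defs.
From mathcomp Require Import all_boot all_fingroup all_solvable.

(* All classes are located in the action on the 100 vertices of the Hall-Janko
   graph. By Sylow's theorem, every element of prime order p is conjugate to an
   element of a given Sylow p-subgroup, and a few explicit conjugations fuse the
   elements of order p of that subgroup into the classes of the ATLAS. Each
   generation claim is witnessed by a pair (a, b) and words in a and b for the
   standard generators. For the other claims, fix z in 7A, let a run through 2A
   (315 elements) or 3A (560 elements), and put b = a^-1 z. If a is in 2A and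
   b^3 = 1, then a and b generate an intransitive group; if a is in 3A, then
   b^2 <> 1; and in both cases, if b^5 = 1, then b maps some vertex to one of
   its neighbours, which no element of 5A or 5B does. *)

Set Implicit Arguments.
Unset Strict Implicit.
Unset Printing Implicit Defensive.

(** * Words for class representatives, Sylow subgroups and generating pairs *)

(* A word denotes a product of the elements J2a * J2b (letter 0) and
   J2a * J2b ^+ 2 (letter 1). *)
Definition w2A := flatten (nseq 6 [:: 0; 1]).
Definition w2B := [:: 0; 0; 1; 0; 0; 1; 0; 1; 0; 0; 0].
(** [w2A] and [w3A] are the sixth and fourth powers of [J2a * J2b * J2a * J2b ^+ 2], which has order
    12. *)
Definition w3A := flatten (nseq 4 [:: 0; 1]).
Definition w3B := [:: 0; 0; 1; 0; 0; 1; 0; 1; 0; 1; 0; 1; 0; 0; 0].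
(** An element of order 15, so that its cube [w5A] visibly commutes with an element of order 3. *)
Definition w15 := [:: 0; 0; 1; 0; 1; 0; 0; 1; 0; 1; 1].
Definition w5A := flatten (nseq 3 w15).
Definition w5B := w5A ++ w5A.
Definition w5C := [:: 1; 0; 0; 1; 0; 1; 0; 1; 1; 0; 1; 0; 0; 0].
Definition w5D := w5C ++ w5C.
Definition w7A := [:: 0].

(** Generators of Sylow subgroups; the [fusion] lists add conjugators that join classes which the
    Sylow subgroup alone keeps apart. *)
Definition sylow2 := [:: [:: 0; 1; 0; 1; 0; 1];
  [:: 0; 0; 0; 0; 1; 0; 1; 0; 0; 1; 0]; [:: 0; 0; 1; 0; 0; 1; 0; 1; 0; 0; 0]].
Definition fusion2 := [:: [:: 1; 0; 1; 0; 1; 0; 0; 1; 0; 1; 0; 1; 1];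
  [:: 1; 0; 1; 0; 0]].
Definition sylow3 := [:: [:: 0; 0; 0; 0; 1; 0; 1; 0; 1; 0; 1; 0; 0; 1; 0];
  [:: 0; 0; 1; 0; 0; 1; 0; 1; 0; 1; 0; 1; 0; 0; 0]].
Definition fusion3 := [:: [:: 0; 1]; [:: 1; 0; 0; 0; 0; 0];
  [:: 1; 0; 1; 1; 0; 1; 0; 0; 1; 0; 1; 0; 1; 0; 0]].
Definition sylow5 := [:: [:: 1; 0; 0; 1; 0; 1; 0; 1; 1; 0; 1; 0; 0; 0];
  [:: 1; 0; 1; 0; 0; 1; 1; 0; 1; 0; 0; 1; 0; 1; 0; 0; 1; 1]].
Definition fusion5 := [:: [:: 0; 1; 0; 0; 0; 0]; [:: 1; 0; 0; 1; 1; 0; 0; 0];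
  [:: 1; 1; 0; 0; 1; 0; 1; 0; 0; 1; 1; 0; 0; 1; 0]].
Definition sylow7 := [:: [:: 0]].
Definition fusion7 := [:: [:: 1; 0; 0; 1; 0; 1; 0; 0; 1; 0; 1; 0; 1; 0; 1; 1; 0;
  1; 0; 1; 0; 1; 0; 1]].

(* The entries (u, v, w, wa, wb) stand for x = pword u, y = pword v ^ pword w
   with x * y of order 7; J2a and J2b are the values of the words wa and wb in
   the letters x (0) and y (1). *)
Definition generating_rows := [::
  (w2B, w3B, [:: 0; 0; 1], [:: 1; 0; 1; 0; 1; 0; 1; 1; 0; 1; 0; 1; 1; 0; 1;
    0; 1; 0; 1; 1; 0; 1; 0; 1; 0], [:: 1; 0; 1; 0; 1; 0; 1; 1; 0; 1; 0; 1;
    1; 0; 1; 0; 1; 1; 0; 1; 0; 1; 0]);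
  (w2A, w5C, [:: 1; 1; 0; 1; 0; 0], [:: 0; 1; 1; 1; 1; 0; 1; 0; 1; 0; 1; 1;
    1; 0; 1; 1; 1; 0; 1; 1; 0; 1; 0; 1; 0; 1; 1; 0; 1; 1; 1], [:: 0; 1; 1;
    1; 0; 1; 1; 0; 1; 1; 1; 0; 1; 1; 1; 0; 1; 0; 1; 0; 1; 1; 0; 1; 0; 1; 1;
    0]);
  (w2A, w5D, [:: 1; 1; 1; 0; 1; 1; 1], [:: 0; 1; 1; 1; 1; 0; 1; 1; 0; 1; 1;
    0; 1; 0; 1; 0; 1; 1; 1; 0; 1; 1; 1; 0; 1; 1; 0; 1; 0; 1; 1], [:: 1; 1;
    0; 1; 1; 0; 1; 0; 1; 1; 1; 1; 0; 1; 1; 0; 1; 1; 1; 0; 1; 0; 1; 0; 1; 0]);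
  (w2B, w5A, [:: 1; 0; 0; 0; 0], [:: 1; 1; 1; 0; 1; 1; 1; 1; 0; 1; 0; 1; 1;
    0; 1; 0; 1; 1; 0; 1; 1; 0; 1; 1; 0], [:: 1; 1; 0; 1; 1; 0; 1; 1; 0; 1;
    0; 1; 1; 1; 1; 0; 1; 1; 1; 0]);
  (w2B, w5B, [:: 0; 1; 0; 1; 0; 0; 1], [:: 0; 1; 0; 1; 0; 1; 0; 1; 1; 0; 1;
    0; 1], [:: 0; 1; 1; 1; 1; 0; 1; 1; 0; 1; 0; 1; 1; 0; 1; 0; 1; 0; 1; 1;
    0; 1; 1; 0; 1; 1; 0; 1; 0]);
  (w2B, w5C, [:: 0; 0; 0; 0; 0; 1; 0], [:: 1; 1; 1; 1; 0; 1; 0; 1; 0; 1; 0;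
    1; 1; 0; 1; 0; 1; 1], [:: 1; 1; 1; 0; 1; 1; 1; 0; 1; 0; 1; 0; 1; 1; 1;
    0; 1; 0; 1; 0; 1; 1; 1; 1; 0; 1; 1]);
  (w2B, w5D, [:: 1; 0; 1; 0; 1], [:: 1; 1; 1; 0; 1; 1; 1; 0; 1; 1; 0; 1; 1;
    1; 0; 1; 1; 0; 1; 1], [:: 1; 0; 1; 1; 1; 0; 1; 1; 0; 1; 1; 1; 1; 0; 1;
    0; 1; 0; 1; 0; 1; 1; 0]);
  (w3A, w5C, [:: 1; 1; 1; 0; 0; 0], [:: 1; 1; 0; 1; 0; 1; 1; 1; 0; 1; 0; 1;
    0; 1; 0; 1], [:: 1; 0; 1; 0; 1; 1; 0; 1; 0; 1; 0; 0; 1; 1; 0; 1; 0; 1;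
    1; 1; 0; 1; 1; 0]);
  (w3A, w5D, [:: 1; 1; 1; 0; 0; 0], [:: 0; 1; 0; 1; 1; 1; 0; 1; 0; 0; 1; 1;
    0; 0; 1; 1], [:: 1; 1; 0; 0; 1; 1; 0; 1; 0; 1; 0; 0; 1; 0; 0; 1; 0; 0;
    1; 0; 0; 1; 1]);
  (w3B, w5A, [:: 1; 1; 1; 0], [:: 0; 1; 0; 1; 1; 0; 1; 1; 0; 0; 1; 0; 1; 1;
    1; 0; 1; 1], [:: 0; 1; 0; 0; 1; 0; 0; 1; 1; 0; 0; 1; 1; 1; 0; 0; 1]);
  (w3B, w5B, [:: 0; 1; 0; 0], [:: 0; 1; 0; 0; 1; 0; 1; 0; 1; 0; 0; 1; 0; 1;
    1; 1; 0; 1], [:: 0; 0; 1; 0; 1; 1; 1; 1; 0; 0; 1; 1; 0; 0; 1; 1; 0; 1;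
    1; 0; 0; 1]);
  (w3B, w5C, [:: 1; 1; 1; 1], [:: 0; 1; 1; 0; 0; 1; 1; 0; 0; 1; 0], [:: 0;
    0; 1; 0; 1; 0; 0; 1; 0; 1; 0; 0; 1; 0; 1; 0; 1; 1; 0]);
  (w3B, w5D, [:: 1; 1; 0; 0; 1], [:: 1; 0; 1; 0; 0; 1; 0; 0; 1; 1; 0; 1; 0;
    0], [:: 0; 1; 0; 0; 1; 1; 1; 1; 0; 0; 1; 0; 0; 1; 1; 0])].

(** * Words as permutations and as tables *)

Import GroupScope.
Import J2Tables.

Definition pgens : seq 'S_100 := [:: J2a * J2b; J2a * J2b * J2b].
Definition pword (w : seq nat) : 'S_100 := \prod_(i <- w) nth 1 pgens i.
Definition tgens := Eval vm_compute in [:: tcomp ta tb; tcomp (tcomp ta tb) tb].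

Lemma tab_pword w : tab (pword w) = tword tgens w.
Proof.
have Dtgens: tgens = map tab pgens by rewrite /= !tabM tab_a tab_b; vm_compute.
elim: w => [|i w IHw]; first by rewrite /pword big_nil tab1.
rewrite /pword big_cons tabM IHw /= Dtgens; congr tcomp.
(* A letter beyond 1 stands for the identity on both sides, by the defaults [1] and [tid]. *)
by case: i => [|[|i]] //=; rewrite !nth_nil tab1.
Qed.

Lemma mem_J2a : J2a \in J2. Proof. by rewrite mem_gen ?set21. Qed.
Lemma mem_J2b : J2b \in J2. Proof. by rewrite mem_gen ?set22. Qed.

Lemma mem_pword w : pword w \in J2.
Proof.
rewrite /pword; elim/big_ind: _ => [||i _]; [exact: group1 | exact: groupM |].
by case: i => [|[|i]] /=; rewrite ?nth_nil ?groupM ?mem_J2a ?mem_J2b.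
Qed.

Lemma pwordM v w : pword (v ++ w) = pword v * pword w.
Proof. by rewrite /pword big_cat. Qed.

Lemma pwordX n w : pword (flatten (nseq n w)) = pword w ^+ n.
Proof.
elim: n => [|n IHn] /=; first by rewrite /pword big_nil.
by rewrite pwordM IHn expgS.
Qed.

Definition tpow n s := iter n (tcomp s) tid.
Definition tconj s t := tcomp (tinv t) (tcomp s t).

Lemma tabX (g : 'S_100) n : tab (g ^+ n) = tpow n (tab g).
Proof. by elim: n => [|n IHn]; rewrite ?tab1 // expgS tabM IHn. Qed.

Lemma tabJ (g h : 'S_100) : tab (g ^ h) = tconj (tab g) (tab h).
Proof. by rewrite conjgE !tabM tabV. Qed.

Lemma tab_eq1 (g : 'S_100) : (tab g == tid) = (g == 1).
Proof. by rewrite -tab1 (inj_eq tab_inj). Qed.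

(** In a finite group, products of generators already exhaust the generated group, so right
    multiplication by [J2a] and [J2b] reaches every element. *)
Lemma J2_ind (P : 'S_100 -> Prop) : P 1 ->
    (forall g, P g -> P (g * J2a)) -> (forall g, P g -> P (g * J2b)) ->
  {in J2, forall g, P g}.
Proof.
move=> P1 Pa Pb g /gen_prodgP[n [c Sc ->]].
elim: n c Sc => [|n IHn] c Sc; first by rewrite big_ord0.
rewrite big_ord_recr /=.
have /set2P[] := Sc ord_max => ->; [apply: Pa | apply: Pb]; apply: IHn => i;
  exact: Sc.
Qed.

(** * Search for the elements reachable from a point *)

(* Tests below are nested conditionals, because && and || do not evaluate
   lazily under call by value. *)
Fixpoint teq (s t : seq nat) :=
  match s, t with
  | x :: s', y :: t' => if eqn x y then teq s' t' else false
  | [::], [::] => true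
  | _, _ => false
  end.

Lemma teqE : teq =2 eq_op.
Proof.
elim=> [|x s IHs] [|y t] //=; rewrite IHs eqseq_cons eqnE.
by case: (x == y).
Qed.

Section Reach.

Variables (T : eqType) (eqb : rel T) (f : T -> seq T) (x0 : T).
Hypothesis eqbE : eqb =2 eq_op.

Fixpoint memb (s : seq T) x :=
  if s is y :: s' then if eqb y x then true else memb s' x else false.

Fixpoint insert (ys todo seen : seq T) :=
  if ys is y :: ys' then
    if memb seen y then insert ys' todo seen
    else insert ys' (y :: todo) (y :: seen)
  else (todo, seen).

(* The result is empty when the fuel n runs out. *)
Fixpoint reach_from n (todo seen : seq T) :=
  if todo is x :: todo' then
    if n is n'.+1 then
      let: (todo1, seen1) := insert (f x) todo' seen in
      reach_from n' todo1 seen1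
    else [::]
  else seen.

Definition reach n := reach_from n [:: x0] [:: x0].

Lemma membE s x : memb s x = (x \in s).
Proof.
elim: s => //= y s ->; rewrite inE eqbE eq_sym.
by case: (x == y).
Qed.

Lemma insertP ys todo seen (r := insert ys todo seen) :
  [/\ forall x, (x \in r.1) = (x \in todo) || (x \in ys) && (x \notin seen),
      forall x, (x \in r.2) = (x \in seen) || (x \in ys)
    & uniq seen -> uniq r.2].
Proof.
rewrite {}/r; elim: ys todo seen => [|y ys IHys] todo seen /=.
  by split=> // x; rewrite ?andbF orbF.
rewrite membE; have [seen_y | seen'y] := ifPn.
  have [r1E r2E uniq_r] := IHys todo seen; split=> // x.
    by rewrite r1E inE; case: eqP => // ->; rewrite seen_y !andbF.
  by rewrite r2E inE; case: eqP => // ->; rewrite seen_y.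
have [r1E r2E uniq_r] := IHys (y :: todo) (y :: seen); split=> [x|x|uniq_s].
- rewrite r1E !inE; case: eqP => [->|_] /=; last by [].
  by rewrite seen'y orbT.
- by rewrite r2E !inE orbCA orbA.
- by apply: uniq_r; rewrite /= seen'y.
Qed.

(** Invariant: the successors of a seen element outside the worklist are seen. Once the worklist is
    empty, [seen] is therefore closed; if the fuel runs out, the result is empty and closure is
    vacuous. *)
Lemma reach_fromP (P : T -> Prop) n todo seen (s := reach_from n todo seen) :
    (forall x y, P x -> y \in f x -> P y) -> {subset todo <= seen} ->
    {in seen, forall x, x \notin todo -> {subset f x <= seen}} -> uniq seen ->
    {in seen, forall x, P x} ->
  [/\ {in s, forall x, {subset f x <= s}}, uniq s, {in s, forall x, P x}
    & s != [::] -> {subset seen <= s}].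
Proof.
rewrite {}/s => Pf; elim: n todo seen => [|n IHn] [|x todo] seen //= todo_sub.
- by move=> seen_f; split=> // [y seen_y | _ y //]; apply: (seen_f y seen_y).
- by move=> seen_f; split=> // [y seen_y | _ y //]; apply: (seen_f y seen_y).
move=> seen_f uniq_s Ps.
have:= insertP (f x) todo seen; case: insert => todo1 seen1 /= [r1E r2E uniq1].
have seen_x: x \in seen by rewrite todo_sub ?mem_head.
have [y|y|||clR uniqR PR sub1] := IHn todo1 seen1.
- rewrite r1E r2E; case/orP=> [todo_y | /andP[-> _]]; last by rewrite orbT.
  by rewrite todo_sub // inE todo_y orbT.
- rewrite r1E r2E negb_or negb_and negbK => seen1y /andP[todo'y old_y] u fyu.
  rewrite r2E; case: (eqVneq y x) fyu => [-> -> | neq_yx fyu].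
    by rewrite orbT.
  have {}seen_y: y \in seen.
    by case/orP: seen1y old_y => // ->.
  by rewrite (seen_f y) // inE negb_or neq_yx.
- exact: uniq1.
- by move=> y; rewrite r2E => /orP[/Ps | /(Pf x y (Ps x seen_x))].
split=> // /sub1 sub_s1 y seen_y; apply: sub_s1.
by rewrite r2E seen_y.
Qed.

Lemma reachP (P : T -> Prop) n :
    P x0 -> (forall x y, P x -> y \in f x -> P y) ->
  [/\ {in reach n, forall x, {subset f x <= reach n}}, uniq (reach n),
      {in reach n, forall x, P x} & reach n != [::] -> x0 \in reach n].
Proof.
move=> P0 Pf; rewrite /reach.
have [//|x -> //|//|x|clR uniqR PR sub0] :=
  @reach_fromP P n [:: x0] [:: x0] Pf; first by rewrite inE => /eqP->.
by split=> // /sub0; apply; apply: mem_head.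
Qed.

Lemma reach_closed n x y : x \in reach n -> y \in f x -> y \in reach n.
Proof.
by have [|//|clR _ _ _] := @reachP (fun=> True) n => // /clR; apply.
Qed.

Lemma reach_uniq n : uniq (reach n).
Proof. by have [|//|_ ? _ _] := @reachP (fun=> True) n. Qed.

Lemma reach_start n : reach n != [::] -> x0 \in reach n.
Proof. by have [|//|_ _ _ ?] := @reachP (fun=> True) n. Qed.

Lemma reach_ind (P : T -> Prop) n :
    P x0 -> (forall x y, P x -> y \in f x -> P y) ->
  {in reach n, forall x, P x}.
Proof. by move=> P0 Pf; have [] := reachP n P0 Pf. Qed.

End Reach.

(** * Fusion of elements of prime order through Sylow subgroups *)

Lemma inH_pwords ws : {in map (tword tgens) ws, forall s, inH J2 s}.
Proof.
by move=> _ /mapP[w _ ->]; rewrite -tab_pword; exists (pword w);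
  rewrite ?mem_pword.
Qed.

Lemma inH_inv (H : {group 'S_100}) s : inH H s -> inH H (tinv s).
Proof. by case=> g Hg <-; exists g^-1; rewrite ?groupV ?tabV. Qed.

(** The fuel is enough for a Sylow 2-subgroup, of order 128. *)
Definition tclosure (S : seq (seq nat)) :=
  reach teq (fun t => [seq tcomp t s | s <- S]) tid 200.

Lemma tgroup_closure S (L := tclosure S) :
    {in S, forall s, inH [set: 'S_100] s} -> L != [::] ->
  #|tgroup S| = size L /\ {in tgroup S, forall g, tab g \in L}.
Proof.
move=> S_perm L_neq0.
have HL: {in L, forall t, inH (tgroup S) t}.
  apply: (reach_ind teqE) => [|s t Hs /mapP[u Su ->]]; first exact: inH1.
  by apply: inH_comp => //; apply: inH_gen Su.
have LH: {in tgroup S, forall g, tab g \in L}.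
  move=> g /gen_prodgP[n [c Sc ->]]; elim: n c Sc => [|n IHn] c Sc.
    by rewrite big_ord0 tab1; apply: (reach_start teqE).
  rewrite big_ord_recr /= tabM; have:= Sc ord_max; rewrite inE => Sc'.
  apply: (reach_closed teqE (IHn _ (fun i => Sc (widen_ord (leqnSn n) i)))).
  exact: (map_f (fun s => tcomp _ s)).
split=> //; rewrite cardE -(size_map tab); apply/perm_size/uniq_perm => //.
- by rewrite (map_inj_uniq tab_inj) enum_uniq.
- exact: (reach_uniq _ _ teqE).
move=> t; apply/mapP/idP=> [[g Hg ->] | /HL[g Hg <-]].
  by apply: LH; rewrite -mem_enum.
by exists g; rewrite ?mem_enum.
Qed.

(* The first components are the inverses of the second ones, precomputed. *)
Definition tpairs (C : seq (seq nat)) := [seq (tinv c, c) | c <- C].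
Definition tconjs (D : seq (seq nat * seq nat)) t :=
  [seq tcomp d.1 (tcomp t d.2) | d <- D].

Lemma tconjsE C t : tconjs (tpairs C) t = [seq tconj t c | c <- C].
Proof. by rewrite /tconjs -map_comp. Qed.

Lemma classJ_closed (gT : finGroupType) (G : {group gT}) (x y h : gT) :
  h \in G -> y \in x ^: G -> y ^ h \in x ^: G.
Proof. by move=> Gh /imsetP[k Gk ->]; rewrite -conjgM memJ_class ?groupM. Qed.

(** Keeping only conjugates in the Sylow subgroup [L] makes the search small. As conjugates outside
    [L] are dropped, iterating a conjugator need not yield its inverse, so inverses are listed
    too. *)
Definition fuse (C L : seq (seq nat)) (s : seq nat) :=
  let D := tpairs (C ++ map tinv C) in
  reach teq (fun t => [seq u <- tconjs D t | memb teq L u]) s 200.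

Lemma fuse_class C L w : {in C, forall c, inH J2 c} ->
  forall g, tab g \in fuse C L (tword tgens w) -> g \in pword w ^: J2.
Proof.
move=> J_C g; pose P t := exists2 k, k \in pword w ^: J2 & t = tab k.
suffices: {in fuse C L (tword tgens w), forall t, P t}.
  by move=> FP /FP[k ? /tab_inj->].
have J_CV: {in C ++ map tinv C, forall c, inH J2 c}.
  move=> c; rewrite mem_cat => /orP[/J_C // | /mapP[c' /J_C Jc' ->]].
  exact: inH_inv.
apply: (reach_ind teqE) => [|_ t [k wk ->]].
  by exists (pword w); rewrite ?class_refl ?tab_pword.
rewrite mem_filter tconjsE => /andP[_ /mapP[c /J_CV[h Jh <-] ->]].
by exists (k ^ h); rewrite ?tabJ // classJ_closed.
Qed.

Definition fusion_check p n (ws cs reps : seq (seq nat)) :=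
  let S := map (tword tgens) ws in
  let C := map (tword tgens) cs in
  let L := tclosure S in
  let F := flatten (map (fuse (S ++ C) L \o tword tgens) reps) in
  (size L == (p ^ n)%N) &&
  all (fun t => if teq t tid then true else
         if teq (tpow p t) tid then memb teq F t else true) L.

(* By Sylow's theorem it is enough to look at the elements of order p of a
   Sylow p-subgroup, generated here by the words ws; these are conjugate to
   the elements of reps under the words ws and cs and their inverses. *)
Lemma fusion_cover p n ws cs reps :
    prime p -> (#|J2|`_p)%N = (p ^ n)%N -> fusion_check p n ws cs reps ->
  {in J2, forall g, #[g] = p -> exists2 w, w \in reps & g \in pword w ^: J2}.
Proof.
move=> pr_p cardJp; rewrite /fusion_check.
set S := map _ ws; set C := map _ cs; set L := tclosure S.
case/andP=> /eqP szL /allP fuseL g Jg og.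
have J_S: {in S, forall s, inH J2 s} := @inH_pwords ws.
have J_SC: {in S ++ C, forall s, inH J2 s}.
  by rewrite -map_cat; apply: inH_pwords.
have [|cardP LP] := tgroup_closure (inH_all J_S).
  by rewrite -size_eq0 szL expn_eq0 -leqn0 leqNgt prime_gt0.
have sylP: p.-Sylow(J2) (tgroup S).
  by rewrite pHallE tgroup_sub //= cardP cardJp -szL.
have pg: p.-group <[g]> by rewrite /pgroup -orderE og pnat_id.
have [h Jh sgP] := Sylow_Jsub sylP (etrans (cycle_subG _ _) Jg) pg.
have Pgh: g ^ h \in tgroup S.
  by apply: (subsetP sgP); rewrite memJ_conjg cycle_id.
have:= fuseL _ (LP _ Pgh); rewrite !teqE (membE teqE) tab_eq1 -tabX tab_eq1.
rewrite -conjXg -og expg_order conj1g eqxx.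
rewrite -order_eq1 orderJ og; case: eqP pr_p => [-> // | _ _ /=].
case/flatten_mapP=> w reps_w /(fuse_class J_SC) wgh; exists w => //.
by rewrite -(conjgK h g) classJ_closed ?groupV.
Qed.

Lemma card_Sylow_J2 (p n : nat) :
    (p, n) \in [:: (2, 7); (3, 3); (5, 2); (7, 1%N)] ->
  (#|J2|`_p)%N = (p ^ n)%N.
Proof.
move=> pn; rewrite card_J2 !partnM ?muln_gt0 ?expn_gt0 //.
move: pn; rewrite !inE => /or4P[] /eqP[-> ->];
  [rewrite (@part_pnat_id 2 2) | rewrite (@part_pnat_id 3 3)
  | rewrite (@part_pnat_id 5 5) | rewrite (@part_pnat_id 7 7)] => //.
all: by rewrite !part_p'nat.
Qed.

(** The representatives are split into two lists by centralizer order, as [class_separation]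
    expects. *)
Lemma order2_J2 : {in J2, forall g, #[g] = 2 ->
  exists2 w, w \in [:: w2A] ++ [:: w2B] & g \in pword w ^: J2}.
Proof.
have chk: fusion_check 2 7 sylow2 fusion2 [:: w2A; w2B] by vm_compute.
exact (@fusion_cover 2 7 _ _ _ isT (@card_Sylow_J2 2 7 isT) chk).
Qed.

Lemma order3_J2 : {in J2, forall g, #[g] = 3 ->
  exists2 w, w \in [:: w3A] ++ [:: w3B] & g \in pword w ^: J2}.
Proof.
have chk: fusion_check 3 3 sylow3 fusion3 [:: w3A; w3B] by vm_compute.
exact (@fusion_cover 3 3 _ _ _ isT (@card_Sylow_J2 3 3 isT) chk).
Qed.

Lemma order5_J2 : {in J2, forall g, #[g] = 5 ->
  exists2 w, w \in [:: w5A; w5B] ++ [:: w5C; w5D] & g \in pword w ^: J2}.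
Proof.
have chk: fusion_check 5 2 sylow5 fusion5 [:: w5A; w5B; w5C; w5D].
  by vm_compute.
exact (@fusion_cover 5 2 _ _ _ isT (@card_Sylow_J2 5 2 isT) chk).
Qed.

Lemma order7_J2 : {in J2, forall g, #[g] = 7 -> g \in pword w7A ^: J2}.
Proof.
have chk: fusion_check 7 1 sylow7 fusion7 [:: w7A] by vm_compute.
move=> g Jg og.
have cardJ: (#|J2|`_7)%N = (7 ^ 1)%N by apply: card_Sylow_J2.
have [w] := fusion_cover (p := 7) isT cardJ chk Jg og.
by rewrite inE => /eqP->.
Qed.

(** * Recognizing classes by centralizer orders *)

(** Elimination replaces the computation of exact centralizer orders: Y has no representative in R,
    hence one in R', where all centralizers then have order m'; as m differs from m', X has its
    representative in R. *)
Lemma class_separation n m m' (R R' : seq (seq nat)) (X Y : {set 'S_100}) :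
    {in J2, forall g, #[g] = n ->
      exists2 w, w \in R ++ R' & g \in pword w ^: J2} ->
    {in R, forall w, #|'C_J2[pword w]| != m'} ->
    {in R' &, forall w v, #|'C_J2[pword w]| = #|'C_J2[pword v]|} -> m != m' ->
    is_class J2 n m X -> is_class J2 n m' Y ->
  (exists2 w, w \in R & X = pword w ^: J2) /\
  (exists2 w, w \in R' & Y = pword w ^: J2).
Proof.
move=> cover cR cR' neq_m [x Jx [ox cx ->]] [y Jy [oy cy ->]].
have classE g w : g \in pword w ^: J2 ->
    g ^: J2 = pword w ^: J2 /\ #|'C_J2[g]| = #|'C_J2[pword w]|.
  move=> wg; have eq_cl: g ^: J2 = pword w ^: J2 by apply/class_eqP.
  split=> //; case/imsetP: wg => h Jh ->.
  by rewrite -{1}(conjGid Jh) cent1J -conjIg cardJg.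
have [w Rw /classE[-> eq_cx]] := cover x Jx ox.
have [v Rv /classE[-> eq_cy]] := cover y Jy oy.
have {}Rv: v \in R'.
  move: Rv; rewrite mem_cat => /orP[/cR | //].
  by rewrite -eq_cy cy eqxx.
split; [exists w => // | by exists v].
move: Rw; rewrite mem_cat => /orP[// | R'w].
by move: neq_m; rewrite -cx -cy eq_cx eq_cy (cR' w v) ?eqxx.
Qed.

(** The fuel covers 2A and 3A, with 315 and 560 elements. *)
Definition tclass w :=
  reach teq (tconjs (tpairs [:: ta; tb])) (tword tgens w) 1000.

Lemma tclassP w : tclass w != [::] ->
  {in pword w ^: J2, forall g, tab g \in tclass w}.
Proof.
move=> w_neq0 _ /imsetP[h Jh ->]; elim/J2_ind: h / Jh => [|h IHh|h IHh].
- by rewrite conjg1 tab_pword; apply: (reach_start teqE).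
- apply: (reach_closed teqE IHh); rewrite tconjsE conjgM tabJ -tab_a.
  by rewrite (map_f (tconj _)) ?mem_head.
- apply: (reach_closed teqE IHh); rewrite tconjsE conjgM tabJ -tab_b.
  by rewrite (map_f (tconj _)) // inE mem_head orbT.
Qed.

(** The list contains the whole class, so its length bounds the index of the centralizer. *)
Lemma card_tclass w : tclass w != [::] ->
  #|J2| <= size (tclass w) * #|'C_J2[pword w]|.
Proof.
move=> w_neq0; rewrite -(Lagrange (subsetIl J2 'C[pword w])) mulnC.
rewrite index_cent1 leq_mul // cardE -(size_map tab).
apply: uniq_leq_size => [|t].
  by rewrite map_inj_uniq ?enum_uniq //; apply: tab_inj.
by case/mapP=> g wg ->; apply: tclassP; rewrite // -mem_enum.
Qed.

Lemma classes2_J2 X Y : is_class J2 2 1920 X -> is_class J2 2 240 Y ->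
  X = pword w2A ^: J2 /\ Y = pword w2B ^: J2.
Proof.
move=> clX clY.
have [|||[w + ->] [v + ->]] := class_separation order2_J2 _ _ _ clX clY.
- move=> w; rewrite inE => /eqP->; apply/eqP=> c2A.
  (* A centralizer of order 240 would give 100 * 96 <= 5 * 240; cancelling 63 keeps the unary
     numerals small. *)
  have n315: size (tclass w2A) = (63 * 5)%N by vm_compute.
  have: tclass w2A != [::] by rewrite -size_eq0 n315.
  move/card_tclass; rewrite n315 c2A (proj1 J2_stab) [(100 * _)%N]mulnCA.
  by rewrite -mulnA leq_pmul2l.
- by move=> w v; rewrite !inE => /eqP-> /eqP->.
- by [].
by rewrite !inE => /eqP-> /eqP->.
Qed.

Lemma classes3_J2 X Y : is_class J2 3 1080 X -> is_class J2 3 36 Y ->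
  X = pword w3A ^: J2 /\ Y = pword w3B ^: J2.
Proof.
move=> clX clY.
have [|||[w + ->] [v + ->]] := class_separation order3_J2 _ _ _ clX clY.
- move=> w; rewrite inE => /eqP->; apply/eqP=> c3A.
  (* The contradiction comes factor by factor: 560 < 63 * 96 and 36 < 100. *)
  have n560: size (tclass w3A) = 560 by vm_compute.
  have: tclass w3A != [::] by rewrite -size_eq0 n560.
  move/card_tclass; rewrite n560 c3A (proj1 J2_stab) mulnC leqNgt.
  by rewrite ltn_mul.
- by move=> w v; rewrite !inE => /eqP-> /eqP->.
- by [].
by rewrite !inE => /eqP-> /eqP->.
Qed.

(* The elements of 5A and 5B, unlike those of 5C and 5D, commute with elements
   of order 3. *)
Lemma classes5_J2 X Y : is_class J2 5 300 X -> is_class J2 5 50 Y ->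
  (exists2 w, w \in [:: w5A; w5B] & X = pword w ^: J2) /\
  (exists2 w, w \in [:: w5C; w5D] & Y = pword w ^: J2).
Proof.
apply: class_separation order5_J2 _ _ _ => //.
  pose u := pword w15.
  have uX k : (u ^+ k == 1) = (tpow k (tword tgens w15) == tid).
    by rewrite -tab_eq1 tabX tab_pword.
  have o3: #[u ^+ 5] = 3.
    apply: nt_prime_order => //; last by rewrite uX; vm_compute.
    by apply/eqP; rewrite -expgM uX; vm_compute.
  have c50 i : #|'C_J2[u ^+ i]| != 50.
    apply/eqP=> c50; suff: #[u ^+ 5] %| #|'C_J2[u ^+ i]| by rewrite o3 c50.
    rewrite order_dvdG // inE groupX ?mem_pword //.
    by apply/cent1P/commuteX/commute_sym/commuteX.
  move=> w; rewrite !inE => /orP[] /eqP->; last first.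
    by rewrite /w5B pwordM /w5A pwordX -expgD c50.
  by rewrite /w5A pwordX c50.
suff: 'C[pword w5D] = 'C[pword w5C].
  by move=> eqC w v; rewrite !inE => /orP[] /eqP-> /orP[] /eqP->; rewrite ?eqC.
rewrite /w5D pwordM; set c := pword _; apply/setP=> g.
apply/cent1P/cent1P=> [cgc2 | cgc]; last exact: commuteM.
(* Since [c] is the cube of its square, whatever commutes with the square commutes with [c]. *)
have c5: c ^+ 5 = 1.
  by apply/eqP; rewrite -tab_eq1 tabX tab_pword; vm_compute.
rewrite -[c]mul1g -c5 -expgSr (expgM c 2 3) /= expg2.
exact: commuteX.
Qed.

Lemma class7_J2 X : is_class J2 7 7 X -> X = pword w7A ^: J2.
Proof. by case=> x Jx [/(order7_J2 Jx) zx _ ->]; apply/class_eqP. Qed.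

(** * Generating triples *)

Definition row_check (r : seq nat * seq nat * seq nat * seq nat * seq nat) :=
  let: (u, v, w, wa, wb) := r in
  let s := tword tgens u in
  let t := tconj (tword tgens v) (tword tgens w) in
  [&& tpow 7 (tcomp s t) == tid, tcomp s t != tid,
      tword [:: s; t] wa == ta & tword [:: s; t] wb == tb].

Lemma generating_rows_check : all row_check generating_rows.
Proof. by vm_compute. Qed.

(** A product of order 7 is automatically in 7A, the only class of such elements; generation follows
    from writing [J2a] and [J2b] as words in the pair. *)
Lemma generating_rowsP u v :
    has (fun r => let: (u', v', _, _, _) := r in (u' == u) && (v' == v))
      generating_rows ->
  triple_generated J2 (pword u ^: J2) (pword v ^: J2) (pword w7A ^: J2).
Proof.
case/hasP=> -[[[[u' v'] w] wa] wb] /(allP generating_rows_check).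
move=> + /andP[/eqP def_u /eqP def_v]; rewrite {u'}def_u {v'}def_v /row_check.
pose x := pword u; pose y := pword v ^ pword w.
rewrite -!tab_pword -tabJ -/x -/y -tabM -tabX !tab_eq1.
case/and4P=> /eqP xy7 ntxy /eqP def_a /eqP def_b.
have Jx: x \in J2 by apply: mem_pword.
have Jy: y \in J2 by rewrite groupJ ?mem_pword.
exists x, y; split; first exact: class_refl.
- by rewrite memJ_class ?mem_pword.
- by apply: order7_J2; [rewrite groupM | apply: nt_prime_order].
have H_xy: {in [:: tab x; tab y], forall s, inH <<[set x; y]>> s}.
  by move=> s; rewrite !inE => /orP[] /eqP->;
    [exists x | exists y]; rewrite // mem_gen ?set21 ?set22.
apply/eqP; rewrite eqEsubset !gen_subG !subUset !sub1set Jx Jy /=.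
have [a Ha] := inH_word wa H_xy; rewrite def_a -tab_a => /tab_inj<-.
have [b Hb] := inH_word wb H_xy; rewrite def_b -tab_b => /tab_inj<-.
exact/andP.
Qed.

(** * Normalized triples and intransitive pairs *)

(** Simultaneous conjugation preserves classes and generation, so the product can be fixed and only
    one factor remains to be enumerated. *)
Lemma triple_normalize u v w :
    triple_generated J2 (pword u ^: J2) (pword v ^: J2) (pword w ^: J2) ->
  exists x y, [/\ x \in pword u ^: J2, y \in pword v ^: J2, x * y = pword w
                & <<[set x; y]>> = J2].
Proof.
case=> x [y [ux vy /imsetP[g Jg def_xy] genJ2]].
exists (x ^ g^-1), (y ^ g^-1); split; rewrite ?classJ_closed ?groupV //.
  by rewrite -conjMg def_xy conjgK.
rewrite -[RHS](conjGid (groupVr Jg)) -genJ2 -genJ conjUg.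
by rewrite !conjg_set1.
Qed.

(** An empty list means exhausted fuel and is no evidence of intransitivity, so it fails the
    test. *)
Definition tintrans s t :=
  let X := reach eqn (fun i => [:: nth 0 s i; nth 0 t i]) 0 100 in
  if X is [::] then false else size X < 100.

Lemma tintransP (x y : 'S_100) :
  tintrans (tab x) (tab y) -> <<[set x; y]>> <> J2.
Proof.
rewrite /tintrans; set X := reach _ _ _ _ => intrX defJ.
have [X_neq0 szX]: X != [::] /\ size X < 100 by case: X intrX.
have eqnE' : eqn =2 eq_op by move=> i j; rewrite eqnE.
have JX g : g \in J2 -> val (g (inord 0)) \in X.
  rewrite -defJ => /gen_prodgP[n [c Sc ->]].
  elim: n c Sc => [|n IHn] c Sc.
    by rewrite big_ord0 perm1 /= inordK // (reach_start eqnE').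
  have IH := IHn _ (fun i => Sc (widen_ord (leqnSn n) i)).
  rewrite big_ord_recr /= permM; apply: (reach_closed eqnE' IH).
  have /set2P[] := Sc ord_max => ->; rewrite !nth_tab ?mem_head //.
  by rewrite !inE eqxx orbT.
have: size tid <= size X.
  apply: uniq_leq_size => [|k]; first exact: iota_uniq.
  rewrite mem_iota add0n => ltk; have [g Jg def_k] := J2_trans (Ordinal ltk).
  by rewrite -[k]/(val (Ordinal ltk)) -def_k JX.
by rewrite leqNgt szX.
Qed.

(** * Automorphisms of the Hall-Janko graph *)

(* The adjacency lists of the Hall-Janko graph: T0 moves the orbit O36 of the
   stabilizer of the vertex 0 to the other vertices. *)
Definition hj := Eval vm_compute in
  [seq [seq nth 0 t q | q <- O36]
     | p <- tid, t <- [seq t <- T0 | nth 0 t 0 == p]].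

Definition adj (p q : nat) := memb eqn (nth [::] hj p) q.

Definition tmoves t := has (fun p => adj p (nth 0 t p)) tid.

Lemma adj_tab : all (fun p => all (fun q =>
  adj (nth 0 ta p) (nth 0 ta q) && adj (nth 0 tb p) (nth 0 tb q))
  (nth [::] hj p)) tid.
Proof. by vm_compute. Qed.

Lemma adjJ2 g (p q : 'I_100) : g \in J2 -> adj p q -> adj (g p) (g q).
Proof.
have eqnE' : eqn =2 eq_op by move=> i j; rewrite eqnE.
have adj_gen (i j : 'I_100) : adj i j ->
    adj (J2a i) (J2a j) && adj (J2b i) (J2b j).
  rewrite {1}/adj (membE eqnE') => adj_ij.
  have /(allP adj_tab)/allP/(_ _ adj_ij): val i \in tid.
    by rewrite mem_iota add0n ltn_ord.
  by rewrite -tab_a -tab_b !nth_tab.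
move=> Jg adj_pq; elim/J2_ind: g / Jg => [|g IHg|g IHg].
- by rewrite !perm1.
- by rewrite !permM; have /andP[] := adj_gen _ _ IHg.
- by rewrite !permM; have /andP[] := adj_gen _ _ IHg.
Qed.

(** Since [h] preserves adjacency, a vertex that [g] moves to a neighbour has as its image under [h]
    such a vertex for [g ^ h]. *)
Lemma tmovesJ g h : h \in J2 -> tmoves (tab g) -> tmoves (tab (g ^ h)).
Proof.
move=> Jh /hasP[p]; rewrite mem_iota add0n => ltp.
pose i := Ordinal ltp; rewrite -[p]/(val i) nth_tab => /(adjJ2 Jh) adj_h.
apply/hasP; exists (val (h i)); first by rewrite mem_iota add0n ltn_ord.
by rewrite nth_tab permJ.
Qed.

(** * Excluded triples, by enumerating 2A and 3A *)

(* Since a ^+ n = 1, tpow n.-1 sends the table s of a to that of a^-1, so that t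
   is the table of the b such that a * b = pword w7A. *)
Definition quotient_check n k w (Q : seq nat -> seq nat -> bool) :=
  let z := tword tgens w7A in
  let L := tclass w in
  [&& tpow n (tword tgens w) == tid, L != [::] &
     all (fun s => let t := tcomp (tpow n.-1 s) z in
       if teq (tpow k t) tid then Q s t else true) L].

Lemma quotientP n k w Q (x y : 'S_100) : quotient_check n k w Q ->
    x \in pword w ^: J2 -> x * y = pword w7A -> y ^+ k = 1 -> 0 < n ->
  Q (tab x) (tab y).
Proof.
case/and3P; rewrite -tab_pword -tabX tab_eq1 => /eqP wn w_neq0 chk wx.
move=> def_z yk n_gt0; have xn: x ^+ n = 1.
  by case/imsetP: wx => g _ ->; rewrite -conjXg wn conj1g.
have /(allP chk) := tclassP w_neq0 wx.
rewrite -tabX -tab_pword -tabM -def_z mulgA -expgSr prednK // xn mul1g.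
by rewrite /= teqE -tabX tab_eq1 yk eqxx.
Qed.

(** Only [y ^+ 3 = 1] matters, so one enumeration of 2A settles 3A and 3B together. *)
Lemma no_2A_order3 v :
  {in pword v ^: J2, forall g, g ^+ 3 = 1} ->
  ~ triple_generated J2 (pword w2A ^: J2) (pword v ^: J2) (pword w7A ^: J2).
Proof.
have chk: quotient_check 2 3 w2A tintrans by vm_compute.
move=> v3 /triple_normalize[x [y [ux /v3 y3 def_z]]].
exact: tintransP (quotientP chk ux def_z y3 isT).
Qed.

Lemma no_order2_3A u :
  {in pword u ^: J2, forall g, g ^+ 2 = 1} ->
  ~ triple_generated J2 (pword u ^: J2) (pword w3A ^: J2) (pword w7A ^: J2).
Proof.
have chk: quotient_check 3 2 w3A (fun _ _ => false) by vm_compute.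
move=> u2 /triple_normalize[x [y [/u2 x2 vy def_z _]]].
(* The factors are exchanged because the check enumerates 3A as the left factor. *)
have def_z': y * x ^ y = pword w7A by rewrite -def_z -conjgC.
suff: (x ^ y) ^+ 2 = 1 by move/(quotientP chk vy def_z')/(_ isT).
by rewrite -conjXg x2 conj1g.
Qed.

(** Both [w5A] and [w5B] are treated, since the label 5A may belong to either class. *)
Lemma no_moving_quotient n u v :
    quotient_check n 5 u (fun _ => tmoves) -> 0 < n -> v \in [:: w5A; w5B] ->
  ~ triple_generated J2 (pword u ^: J2) (pword v ^: J2) (pword w7A ^: J2).
Proof.
move=> chk n_gt0 AB_v /triple_normalize[x [y [ux vy def_z _]]].
have fixAB: all (fun w => ~~ tmoves (tword tgens w)) [:: w5A; w5B].
  by vm_compute.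
have pow5: all (fun w => tpow 5 (tword tgens w) == tid) [:: w5A; w5B].
  by vm_compute.
have [g Jg def_y] := imsetP vy.
have y5: y ^+ 5 = 1.
  rewrite def_y -conjXg; have /eqP := allP pow5 v AB_v.
  by rewrite -tab_pword -tabX -tab1 => /tab_inj->; rewrite conj1g.
have moves_v: tmoves (tab (pword v)).
  rewrite -[pword v](conjgK g) -def_y; apply: tmovesJ; first by rewrite groupV.
  exact: (quotientP chk ux def_z y5 n_gt0).
have /negP[] := allP fixAB v AB_v.
by rewrite -tab_pword.
Qed.

Lemma no_2A_5AB v : v \in [:: w5A; w5B] ->
  ~ triple_generated J2 (pword w2A ^: J2) (pword v ^: J2) (pword w7A ^: J2).
Proof.
have chk: quotient_check 2 5 w2A (fun _ => tmoves) by vm_compute.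
exact: no_moving_quotient chk isT.
Qed.

Lemma no_3A_5AB v : v \in [:: w5A; w5B] ->
  ~ triple_generated J2 (pword w3A ^: J2) (pword v ^: J2) (pword w7A ^: J2).
Proof.
have chk: quotient_check 3 5 w3A (fun _ => tmoves) by vm_compute.
exact: no_moving_quotient chk isT.
Qed.

(** * Transport along an isomorphism *)

Section Transport.

Variables (aT rT : finGroupType) (G : {group aT}) (f : {morphism G >-> rT}).
Hypothesis inj_f : 'injm f.

Lemma is_class_sub n m C : is_class G n m C -> C \subset G.
Proof. by case=> x Gx [_ _ ->]; apply: class_subG. Qed.

Lemma morphim_is_class n m C :
  is_class G n m C -> is_class (f @* G) n m (f @* C).
Proof.
case=> x Gx [ox cx ->]; exists (f x); first exact: mem_morphim.
by rewrite order_injm // -injm_subcent1 // card_injm ?subsetIl ?morphim_class.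
Qed.

Lemma morphim_triple_generated (C1 C2 C3 : {set aT}) :
    C1 \subset G -> C2 \subset G -> C3 \subset G ->
  triple_generated (f @* G) (f @* C1) (f @* C2) (f @* C3) <->
  triple_generated G C1 C2 C3.
Proof.
move=> sC1 sC2 sC3.
have gen_f a b : a \in G -> b \in G ->
    <<[set f a; f b]>> = f @* <<[set a; b]>>.
  move=> Ga Gb; rewrite morphim_gen ?morphimU ?morphim_set1 //.
  by rewrite subUset !sub1set Ga.
have sub_f a b : a \in G -> b \in G -> <<[set a; b]>> \subset G.
  by move=> Ga Gb; rewrite gen_subG subUset !sub1set Ga.
split=> [[_ [_ [/morphimP[a Ga C1a ->] /morphimP[b Gb C2b ->]]]] | ].
  rewrite -morphM // gen_f // => /morphimP[c Gc C3c /(injmP inj_f) def_c].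
  move/(injm_morphim_inj inj_f (sub_f _ _ Ga Gb) (subxx G)) => gen_ab.
  by exists a, b; rewrite def_c ?groupM.
case=> a [b [C1a C2b C3ab gen_ab]].
have [Ga Gb] := (subsetP sC1 a C1a, subsetP sC2 b C2b).
exists (f a), (f b); rewrite -morphM // gen_f // gen_ab.
by rewrite !mem_morphim ?groupM.
Qed.

End Transport.

(** The image [f @* C] sees only the part of C inside G, whence the inclusion. *)
Definition corresponds (gT : finGroupType) (G : {group gT})
    (f : {morphism G >-> 'S_100}) (C : {set gT}) (w : seq nat) :=
  C \subset G /\ f @* C = pword w ^: J2.

Lemma tripleJ2P (gT : finGroupType) (G : {group gT})
    (f : {morphism G >-> 'S_100}) C1 C2 C3 w1 w2 w3 :
    'injm f -> f @* G = J2 ->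
    corresponds f C1 w1 -> corresponds f C2 w2 -> corresponds f C3 w3 ->
  triple_generated G C1 C2 C3 <->
  triple_generated J2 (pword w1 ^: J2) (pword w2 ^: J2) (pword w3 ^: J2).
Proof.
move=> inj_f fG [sC1 <-] [sC2 <-] [sC3 <-].
have <-: (f @* G)%G = J2 by apply: val_inj.
by apply: iff_sym; apply: morphim_triple_generated.
Qed.

Theorem theorem3p5 (gT : finGroupType) (G : {group gT}) (K : ATLAS_classes G) :
  G \isog J2 ->
  (triple_generated G (c2B K) (c3B K) (c7A K) /\
   triple_generated G (c2A K) (c5C K) (c7A K) /\
   triple_generated G (c2B K) (c5A K) (c7A K) /\
   triple_generated G (c2B K) (c5C K) (c7A K) /\
   triple_generated G (c3A K) (c5C K) (c7A K) /\
   triple_generated G (c3B K) (c5A K) (c7A K) /\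
   triple_generated G (c3B K) (c5C K) (c7A K)) /\
  (~ triple_generated G (c2A K) (c3A K) (c7A K) /\
   ~ triple_generated G (c2A K) (c3B K) (c7A K) /\
   ~ triple_generated G (c2B K) (c3A K) (c7A K) /\
   ~ triple_generated G (c2A K) (c5A K) (c7A K) /\
   ~ triple_generated G (c3A K) (c5A K) (c7A K)).
Proof.
case/isogP=> f inj_f fG.
have classJ2 n m C : is_class G n m C -> is_class J2 n m (f @* C).
  have <-: (f @* G)%G = J2 by apply: val_inj.
  exact: morphim_is_class.
have corr C w n m : is_class G n m C -> f @* C = pword w ^: J2 ->
  corresponds f C w by move/is_class_sub.
have powX C w n m : is_class G n m C -> corresponds f C w ->
    {in pword w ^: J2, forall g, g ^+ n = 1}.
  move=> /classJ2[x _ [<- _ def_x]] [_ <-]; rewrite def_x => _ /imsetP[h _ ->].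
  by rewrite -conjXg expg_order conj1g.
have [cl2A cl2B] := (c2A_class K, c2B_class K).
have [cl3A cl3B] := (c3A_class K, c3B_class K).
have [cl5A cl5C] := (c5A_class K, c5C_class K).
have cl7A := c7A_class K.
have [/(corr _ _ _ _ cl2A) co2A /(corr _ _ _ _ cl2B) co2B] :=
  classes2_J2 (classJ2 _ _ _ cl2A) (classJ2 _ _ _ cl2B).
have [/(corr _ _ _ _ cl3A) co3A /(corr _ _ _ _ cl3B) co3B] :=
  classes3_J2 (classJ2 _ _ _ cl3A) (classJ2 _ _ _ cl3B).
(* The labelling leaves open which of two classes is 5A, and which is 5C; [u] and [v] stand for
   either choice, and all of them are checked below. *)
have [[u uAB /(corr _ _ _ _ cl5A) co5A] [v vCD /(corr _ _ _ _ cl5C) co5C]] :=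
  classes5_J2 (classJ2 _ _ _ cl5A) (classJ2 _ _ _ cl5C).
have /(corr _ _ _ _ cl7A) co7A := class7_J2 (classJ2 _ _ _ cl7A).
have gen5A w : w \in [:: w2B; w3B] ->
    triple_generated J2 (pword w ^: J2) (pword u ^: J2) (pword w7A ^: J2).
  by move: uAB; rewrite !inE => /orP[] /eqP-> /orP[] /eqP->;
    apply: generating_rowsP; vm_compute.
have gen5C w : w \in [:: w2A; w2B; w3A; w3B] ->
    triple_generated J2 (pword w ^: J2) (pword v ^: J2) (pword w7A ^: J2).
  by move: vCD; rewrite !inE => /orP[] /eqP-> /or4P[] /eqP->;
    apply: generating_rowsP; vm_compute.
split.
  split; first by apply/(tripleJ2P inj_f fG co2B co3B co7A)/generating_rowsP;
    vm_compute.
  split; first by apply/(tripleJ2P inj_f fG co2A co5C co7A)/gen5C;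
    rewrite !inE eqxx.
  split; first by apply/(tripleJ2P inj_f fG co2B co5A co7A)/gen5A;
    rewrite !inE eqxx.
  split; first by apply/(tripleJ2P inj_f fG co2B co5C co7A)/gen5C;
    rewrite !inE eqxx.
  split; first by apply/(tripleJ2P inj_f fG co3A co5C co7A)/gen5C;
    rewrite !inE eqxx.
  split; first by apply/(tripleJ2P inj_f fG co3B co5A co7A)/gen5A;
    rewrite !inE eqxx.
  by apply/(tripleJ2P inj_f fG co3B co5C co7A)/gen5C; rewrite !inE eqxx.
split.
  move/(tripleJ2P inj_f fG co2A co3A co7A).
  exact/no_2A_order3/(powX _ _ _ _ cl3A co3A).
split.
  move/(tripleJ2P inj_f fG co2A co3B co7A).
  exact/no_2A_order3/(powX _ _ _ _ cl3B co3B).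
split.
  move/(tripleJ2P inj_f fG co2B co3A co7A).
  exact/no_order2_3A/(powX _ _ _ _ cl2B co2B).
split; first by move/(tripleJ2P inj_f fG co2A co5A co7A); apply: no_2A_5AB uAB.
by move/(tripleJ2P inj_f fG co3A co5A co7A); apply: no_3A_5AB uAB.
Qed.
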